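(* Every 2space is of the form $S(\mathbf L)$ for some distributive bisemilattice $\mathbf L$, that is, it is isomorphic, as a 2space, to $S(\mathbf L)$.
   Context: **Bisemilattices.** A distributive bisemilattice is an algebra $\langle A,\land,\lor\rangle$ with both operations idempotent, commutative and associative, each distributing over the other. Write $a\le_\land b$ iff $a\land b=a$, and $a\le_\lor b$ iff $a\lor b=b$. Filters are nonempty subsets upward closed for $\le_\land$ and closed under $\land$; ideals are nonempty subsets downward closed for $\le_\lor$ and closed under $\lor$. $\mathcal F(L)$ and $\mathcal I(L)$ denote the sets of filters and ideals. **Fspaces.** An Fspace is a Stone space $X$ with a partial order $\le$ such that: (1) every subset has a greatest lower bound; (2) there is a clopen subbasis $\{X_i\}_{i\in I}\cup\{\overline X_i\}_{i\in I}$, where each $X_i=\{x:x_i\le x\}$ for a point $x_i$ and $\overline X_i=X\setminus X_i$; (3) every $x$ is the least upper bound of $\{x_i:x_i\le x\}$; (4) $X^*=\{X_i\}$ is closed under finite intersections. Put $\overline X^*=\{\overline X_i\}$. **2spaces.** A 2space $\langle X,\rho,Y\rangle$ consists of: - Fspaces $X,Y$ with subbases $\{X_a\}_{a\in A}\cup\{\overline X_a\}_{a\in A}$ and $\{Y_a\}_{a\in A}\cup\{\overline Y_a\}_{a\in A}$ over a common index set $A$; - a bijection $\rho:X^*\to\overline Y^*$ with $\rho(X_a)=\overline Y_a$, satisfying $P\cap\rho^{-1}(\rho(Q)\cup\rho(R))=\rho^{-1}(\rho(P\cap Q)\cup\rho(P\cap R))$ for $P,Q,R\in X^*$, and $P\cup\rho(\rho^{-1}(Q)\cap\rho^{-1}(R))=\rho(\rho^{-1}(P\cup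 Q)\cap\rho^{-1}(P\cup R))$ for $P,Q,R\in\overline Y^*$. **$S(\mathbf L)$.** For a distributive bisemilattice $\mathbf L$, $S(\mathbf L)=\langle\mathcal F(L),\rho,\mathcal I(L)\rangle$, where: - filters and ideals are ordered by inclusion; - the subbases are $X_a=\{F\in\mathcal F(L):a\in F\}$, $Y_a=\{I\in\mathcal I(L):a\in I\}$ and their complements; - $\rho(X_a)=\overline Y_a$. *)

(* Defs.v *)
From HB Require Import structures.
From mathcomp Require Import all_boot all_order finmap.
From mathcomp Require Import all_classical all_reals all_analysis.
Set Implicit Arguments.
Unset Strict Implicit.
Unset Printing Implicit Defensive.
Import Order.TTheory.
Local Open Scope classical_set_scope.

HB.mixin Record isDistrBisemilattice L := {
  bmeet : L -> L -> L;
  bjoin : L -> L -> L;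
  bmeetxx : idempotent_op bmeet;
  bmeetC : commutative bmeet;
  bmeetA : associative bmeet;
  bjoinxx : idempotent_op bjoin;
  bjoinC : commutative bjoin;
  bjoinA : associative bjoin;
  bmeetUr : right_distributive bmeet bjoin;
  bjoinIr : right_distributive bjoin bmeet
}.

#[short(type="distrBisemilatticeType")]
HB.structure Definition DistrBisemilattice := { L of isDistrBisemilattice L }.

Section FiltersIdeals.
Context {L : distrBisemilatticeType}.

Definition le_meet (a b : L) : Prop := bmeet a b = a.
Definition le_join (a b : L) : Prop := bjoin a b = b.

Definition bfilter (F : set L) : Prop :=
  [/\ F !=set0,
      forall a b, le_meet a b -> F a -> F b &
      forall a b, F a -> F b -> F (bmeet a b)].

Definition bideal (I : set L) : Prop :=
  [/\ I !=set0,
      forall a b, le_join a b -> I b -> I a &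
      forall a b, I a -> I b -> I (bjoin a b)].

End FiltersIdeals.

Definition filters (L : distrBisemilatticeType) : Type :=
  set_type [set F : set L | bfilter F].
Definition ideals (L : distrBisemilatticeType) : Type :=
  set_type [set I : set L | bideal I].

Definition has_mem_filter (L : distrBisemilatticeType) (a : L) :
  set (filters L) := [set F | sval F a].
Definition has_mem_ideal (L : distrBisemilatticeType) (a : L) :
  set (ideals L) := [set I | sval I a].

Definition with_compl (X : Type) (B : set (set X)) : set (set X) :=
  B `|` setC @` B.

(* The order inherited from [set L] is inclusion; see [filters_leE] and
   [ideals_leE]. *)
Section FiltersIdealsInstances.
Variable L : distrBisemilatticeType.

HB.instance Definition _ := SubChoice.copy (filters L)
  (set_type [set F : set L | bfilter F]).
HB.instance Definition _ :=
  [SubChoice_isSubPOrder of filters L by <: with set_display].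
HB.instance Definition _ := @isSubBaseTopological.Build (filters L)
  (set (filters L)) (with_compl (range (@has_mem_filter L))) id.

HB.instance Definition _ := SubChoice.copy (ideals L)
  (set_type [set I : set L | bideal I]).
HB.instance Definition _ :=
  [SubChoice_isSubPOrder of ideals L by <: with set_display].
HB.instance Definition _ := @isSubBaseTopological.Build (ideals L)
  (set (ideals L)) (with_compl (range (@has_mem_ideal L))) id.

Lemma filters_leE (F G : filters L) : (F <= G)%O = (sval F `<=` sval G) :> Prop.
Proof. exact: subsetEset. Qed.

Lemma ideals_leE (I J : ideals L) : (I <= J)%O = (sval I `<=` sval J) :> Prop.
Proof. exact: subsetEset. Qed.

End FiltersIdealsInstances.

Definition stone_space (X : topologicalType) : Prop :=
  [/\ compact [set: X], hausdorff_space X & totally_disconnected [set: X]].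

Definition clopen_subbasis (X : topologicalType) (B : set (set X)) : Prop :=
  B `<=` clopen /\ basis (finI_from B id).

(* The points [x a] are determined by the sets [Xs a], by antisymmetry.
   [finI_from] includes the empty intersection, so the last clause puts
   [setT] in [range Xs]. *)
Definition Fspace d (X : POrderedTopological.type d) (A : Type)
    (Xs : A -> set X) : Prop :=
  [/\ stone_space X,
      forall S : set X, infimums S !=set0,
      clopen_subbasis (with_compl (range Xs)),
      exists x : A -> X,
        (forall a, Xs a = [set y | (x a <= y)%O]) /\
        (forall y, supremums [set x a | a in [set a | (x a <= y)%O]] y) &
      finI_from (range Xs) id `<=` range Xs].

(* The values of [rho] outside [range lsub] are irrelevant. *)
Record twospace_data := TwospaceData {
  ldisp : Order.disp_t;
  rdisp : Order.disp_t;
  lspace : POrderedTopological.type ldisp;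
  rspace : POrderedTopological.type rdisp;
  idx : Type;
  lsub : idx -> set lspace;
  rsub : idx -> set rspace;
  rho : set lspace -> set rspace
}.

Definition lstar (T : twospace_data) : set (set (lspace T)) :=
  range (@lsub T).
Definition rcostar (T : twospace_data) : set (set (rspace T)) :=
  setC @` range (@rsub T).

Definition rho_inv (T : twospace_data) : set (rspace T) -> set (lspace T) :=
  'pinv_(fun=> set0) (@lstar T) (@rho T).

Definition twospace (T : twospace_data) : Prop :=
  [/\ Fspace (@lsub T) /\ Fspace (@rsub T),
      set_bij (@lstar T) (@rcostar T) (@rho T),
      forall a, rho (lsub a) = ~` rsub a :> set (rspace T),
      forall P Q R : set (lspace T), lstar P -> lstar Q -> lstar R ->
        P `&` rho_inv (rho Q `|` rho R) =
        rho_inv (rho (P `&` Q) `|` rho (P `&` R)) &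
      forall P Q R : set (rspace T), rcostar P -> rcostar Q -> rcostar R ->
        P `|` rho (rho_inv Q `&` rho_inv R) =
        rho (rho_inv (P `|` Q) `&` rho_inv (P `|` R))].

Definition homeomorphism (X Y : topologicalType) (f : X -> Y) : Prop :=
  continuous f /\
  exists g : Y -> X, [/\ cancel f g, cancel g f & continuous g].

Definition Fspace_iso d d' (X : POrderedTopological.type d)
    (Y : POrderedTopological.type d') (A B : Type)
    (Xs : A -> set X) (Ys : B -> set Y) (f : X -> Y) : Prop :=
  [/\ homeomorphism f,
      {mono f : x y / (x <= y)%O} &
      [set f @` P | P in range Xs] = range Ys].

Definition twospace_iso (T U : twospace_data) : Prop :=
  exists (f : lspace T -> lspace U) (g : rspace T -> rspace U),
    [/\ Fspace_iso (@lsub T) (@lsub U) f,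
        Fspace_iso (@rsub T) (@rsub U) g &
        forall P : set (lspace T), lstar P -> g @` rho P = rho (f @` P)].

(* The union is over a single [a] when [P] is some [has_mem_filter a], and
   over none otherwise; see [rho_of_has_mem]. *)
Definition rho_of (L : distrBisemilatticeType) (P : set (filters L)) :
    set (ideals L) :=
  \bigcup_(a in [set a | has_mem_filter a = P]) ~` has_mem_ideal a.

Lemma rho_of_has_mem (L : distrBisemilatticeType) (a : L) :
  rho_of (has_mem_filter a) = ~` has_mem_ideal a.
Proof.
have le_of (b c : L) : has_mem_filter b = has_mem_filter c -> le_meet c b.
  move=> bc; pose F := [set e | le_meet c e].
  have fF : bfilter F.
    split; rewrite /F /le_meet /=; first by exists c; exact: bmeetxx.
    - by move=> e g eg ce; rewrite -ce -bmeetA eg.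
    - by move=> e g ce cg; rewrite bmeetA ce.
  have FS : F \in [set F : set L | bfilter F] by rewrite inE.
  have : has_mem_filter c (exist _ F FS : filters L) by exact: bmeetxx.
  by rewrite -bc.
apply/seteqP; split=> [J [b ba]|J nJ]; last by exists a.
suff -> : b = a by [].
by rewrite -(le_of _ _ (esym ba)) bmeetC (le_of _ _ ba).
Qed.

Definition twospace_of (L : distrBisemilatticeType) : twospace_data :=
  @TwospaceData _ _ (filters L) (ideals L) L
    (@has_mem_filter L) (@has_mem_ideal L) (@rho_of L).

(* Main.v *)
Require Import Defs.
From HB Require Import structures.
From mathcomp Require Import all_boot all_order finmap.
From mathcomp Require Import all_classical all_reals all_analysis.
Set Implicit Arguments.
Unset Strict Implicit.
Unset Printing Implicit Defensive.
Import Order.TTheory.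
Local Open Scope classical_set_scope.

(* L is the set X* of basic clopen sets of the left Fspace, with P /\ Q the
   intersection and P \/ Q the set such that rho(P \/ Q) = rho(P) U rho(Q);
   the two identities imposed on rho are the two distributive laws. A point x
   is determined by its trace {P in X* | x in P}, which is a filter of L, and
   every filter is a trace by compactness; the points of the right Fspace give
   the ideals in the same way, y being sent to {P in X* | y not in rho(P)}.
   Both bijections match the subbases, so they are order-preserving
   homeomorphisms; the Fspace axioms for S(L) are transported along them. *)

(** * General topology: bases, subbases and compactness *)

(** Turns the definition of a topology generated by a subbase, as in [filters L] and [ideals L],
    into a [basis]. *)
Lemma open_from_basis (X : topologicalType) (B : set (set X)) :
  @open X = [set \bigcup_(U in D) U | D in subset^~ B] -> basis B.
Proof.
move=> openE; split=> [U BU|x U].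
  by rewrite openE; exists [set U]; [move=> _ -> | exact: bigcup_set1].
rewrite nbhsE => -[V [oV Vx] VU].
move: oV Vx VU; rewrite openE => -[D DB <-] [W DW Wx] DU.
exists W; first by split=> //; exact: DB.
by move=> y Wy; apply: DU; exists W.
Qed.

Lemma continuous_subbasis (X Y : topologicalType) (D : set (set Y))
    (f : X -> Y) : basis (finI_from D id) ->
  (forall V, D V -> open (f @^-1` V)) -> continuous f.
Proof.
move=> [_ bD] oD x U /bD [B [[D' D'D DB] Bfx] BU].
apply: (filterS (P := f @^-1` B)); first exact: preimage_subset.
have -> : f @^-1` B = \bigcap_(V in [set` D']) (f @^-1` V).
  by rewrite -DB; apply/seteqP; split.
apply: filter_bigI => V VD'; apply: open_nbhs_nbhs; split.
  by apply: oD; exact/set_mem/D'D.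
by move: Bfx; rewrite -DB; exact.
Qed.

Lemma finI_from_sub (T : Type) (B : set (set T)) :
  B setT -> setI_closed B -> finI_from B id `<=` B.
Proof.
move=> BT BI _ [D DB <-].
have {DB} DB : forall V, V \in D -> B V by move=> V /DB /set_mem.
by rewrite bigcap_fset big_seq; apply: (big_ind B).
Qed.

Lemma zero_dimensional_hausdorff (X : topologicalType) :
  zero_dimensional X -> hausdorff_space X.
Proof.
move=> X0; rewrite open_hausdorff => x y /X0 [U [[oU cU] Ux Uy]].
exists (U, ~` U); first by split; rewrite inE.
by split=> //=; [exact: closed_openC|rewrite setICr eqxx].
Qed.

(** [D] generates a proper filter, and a cluster point of it lies in every closed member. *)
Lemma compact_finI_bigcap (X : topologicalType) (D : set (set X)) :
  compact [set: X] -> D `<=` closed -> finI D id ->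
  \bigcap_(V in D) V !=set0.
Proof.
move=> cX clD fD; have FD := finI_filter fD.
have [x [_ clx]] := cX _ FD (@filterT _ _ FD).
exists x => V DV; apply: (clD _ DV) => U.
by apply: clx; exists V => //; exact: finI_from1.
Qed.

(** * Fspaces: reindexing, order and traces of points *)

(** Only the generators depend on the indexing, and equal basic sets have generators with the same
    points above them, so the suprema are unaffected. *)
Lemma Fspace_range d (X : POrderedTopological.type d) (A B : Type)
    (Xs : A -> set X) (Ys : B -> set X) :
  range Xs = range Ys -> Fspace Xs -> Fspace Ys.
Proof.
move=> XY [stX infX subX [x [xE xsup]] finX].
split=> //; try by rewrite -XY.
have /choice [h hE] : forall b, exists a, Xs a = Ys b.
  move=> b; have : range Ys (Ys b) by exists b.
  by rewrite -XY => -[a _ <-]; exists a.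
exists (x \o h); split=> [b|y]; first by rewrite /= -xE hE.
split=> [_ /= [b hb <-]//|z zub].
apply: (xsup y).2 => _ /= [a ay <-].
have : range Xs (Xs a) by exists a.
rewrite XY => -[b _ bE].
have xh : forall w, (x (h b) <= w)%O = (x a <= w)%O :> Prop.
  move=> w; have := hE b; rewrite bE !xE => /(congr1 (@^~ w)) /=.
  exact.
rewrite -xh; apply: zub => /=; exists b => //=.
by rewrite xh.
Qed.

(** Each [x] is the supremum of the generators below it, so a [y] above all of these is above
    [x]. *)
Lemma Fspace_leP d (X : POrderedTopological.type d) (A : Type)
    (Xs : A -> set X) (x y : X) :
  Fspace Xs -> (x <= y)%O <-> forall a, Xs a x -> Xs a y.
Proof.
move=> [_ _ _ [p [pE psup]] _]; split=> [xy a|xy].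
  by rewrite pE /= => ax; exact: le_trans xy.
by apply: (psup x).2 => _ /= [a ax <-]; have := xy a; rewrite pE; exact.
Qed.

(* Compactness: any finite part of the trace contains a least principal
   set, whose generator realises that part. *)
Lemma Fspace_trace d (X : POrderedTopological.type d) (L : Type)
    (m : L -> L -> L) (t : L) (Xs : L -> set X) (S : set L) :
  Fspace Xs ->
  (forall a b, Xs (m a b) = Xs a `&` Xs b) -> Xs t = setT ->
  S t -> (forall a b, S a -> S b -> S (m a b)) ->
  (forall a b, Xs a `<=` Xs b -> S a -> S b) ->
  exists x, forall a, Xs a x <-> S a.
Proof.
move=> [[cX _ _] _ [clX _] [p [pE _]] _] Xm Xt St Sm Sup.
(* A point common to all members of [D] has trace exactly [S]. *)
pose D := Xs @` S `|` (fun a => ~` Xs a) @` ~` S.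
have clo V : D V -> closed V.
  case=> -[a _ <-]; apply: (clX _ _).2.
    by left; exists a.
  by right; exists (Xs a) => //; exists a.
have low (s : seq (set X)) : (forall V, V \in s -> D V) ->
    exists2 a, S a & forall V, V \in s -> (Xs @` S) V -> Xs a `<=` V.
  elim: s => [_|V s IH Vs]; first by exists t.
  have [|a Sa aP] := IH; first by move=> W Ws; apply: Vs; rewrite inE Ws orbT.
  have [[b Sb bV]|nV] := pselect ((Xs @` S) V).
    exists (m a b); first exact: Sm.
    move=> W; rewrite inE => /orP[/eqP -> _|Ws SW].
      by rewrite Xm -bV; exact: subIsetr.
    by rewrite Xm; apply: subset_trans (aP _ Ws SW); exact: subIsetl.
  exists a => // W; rewrite inE => /orP[/eqP ->//|]; exact: aP.
have [||x xD] := @compact_finI_bigcap X D cX; first exact: clo.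
  move=> D' D'D; have [|a Sa aP] := low (enum_fset D').
    by move=> V VD; exact/set_mem/D'D.
  (* [p a] also avoids [Xs b] for [b] outside [S]: otherwise [Xs a] would lie inside [Xs b], putting
     [b] in [S]. *)
  exists (p a) => V /= VD.
  have aa : Xs a (p a) by rewrite pE /=.
  case: (set_mem (D'D _ VD)) => [SV|[b nSb <-] ba]; first exact: aP.
  apply: nSb; apply: Sup Sa => y.
  by move: ba; rewrite !pE /=; exact: le_trans.
exists x => a; split=> [ax|Sa]; last by apply: xD; left; exists a.
apply: contrapT => nSa.
by have : (~` Xs a) x by apply: xD; right; exists a.
Qed.

(** * Transport of the Fspace structure along traces *)

(** Serves filters, with [m] the meet, and ideals, with [m] the join. [f] preserves traces,
    [Fspace_trace] provides its inverse [g], and preimages under both match the subbases. *)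
Lemma Fspace_iso_mem d d' (X : POrderedTopological.type d)
    (Z : POrderedTopological.type d') (L : Type) (m : L -> L -> L) (t : L)
    (Xs : L -> set X) (mem : L -> set Z) :
  Fspace Xs -> injective Xs ->
  (forall a b, Xs (m a b) = Xs a `&` Xs b) -> Xs t = setT ->
  (forall a b, mem (m a b) = mem a `&` mem b) -> mem t = setT ->
  (forall z w : Z, (z <= w)%O <-> forall a, mem a z -> mem a w) ->
  basis (finI_from (with_compl (range mem)) id) ->
  (forall x, exists z, forall a, mem a z <-> Xs a x) ->
  Fspace mem /\
  exists2 f : X -> Z, Fspace_iso Xs mem f & forall a, f @` Xs a = mem a.
Proof.
move=> hX Xinj Xm Xt memm memt memle bZ /choice [f fE].
have /choice [g gE] : forall z, exists x, forall a, Xs a x <-> mem a z.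
  move=> z; apply: (Fspace_trace (m := m) (t := t) hX) => //.
  - by rewrite memt.
  - by move=> a b za zb; rewrite memm.
  (* Injectivity of [Xs] turns the inclusion into the equation [m a b = a], which carries over to
     [mem]. *)
  - move=> a b ab za; suff ma : m a b = a by move: za; rewrite -ma memm => -[].
    by apply: Xinj; rewrite Xm; exact/setIidPl.
have fg : cancel f g.
  by move=> x; apply/le_anti/andP; split; apply/(Fspace_leP _ _ hX) => a;
    rewrite gE fE.
have gf : cancel g f.
  by move=> z; apply/le_anti/andP; split; apply/memle => a; rewrite fE gE.
have [[cX _ _] infX [clX bX] [p [pE _]] _] := hX.
have fim V : f @` V = g @^-1` V.
  apply/seteqP; split=> [_ [x Vx <-]|z Vz] /=; first by rewrite fg.
  by exists (g z) => //; rewrite gf.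
have gpre a : g @^-1` Xs a = mem a.
  by apply/seteqP; split=> z /=; rewrite gE.
have fpre a : f @^-1` mem a = Xs a.
  by apply/seteqP; split=> x /=; rewrite fE.
have fimX a : f @` Xs a = mem a by rewrite fim gpre.
have fle x y : (f x <= f y)%O = (x <= y)%O.
  by apply/idP/idP => [/memle xy|/(Fspace_leP _ _ hX) xy];
    [apply/(Fspace_leP _ _ hX) => a|apply/memle => a];
    have := xy a; rewrite !fE.
have gle z w : (g z <= g w)%O = (z <= w)%O by rewrite -fle !gf.
have openX a : open (Xs a) /\ open (~` Xs a).
  split; apply: (clX _ _).1; first by left; exists a.
  by right; exists (Xs a) => //; exists a.
have cf : continuous f.
  apply: (continuous_subbasis bZ) => V [[a _ <-]|[_ [a _ <-] <-]].
    by rewrite fpre; exact: (openX a).1.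
  by rewrite -preimage_setC fpre; exact: (openX a).2.
have Zop a : open (mem a) /\ open (~` mem a).
  split; apply: bZ.1; apply: (finI_from1 id).
    by left; exists a.
  by right; exists (mem a) => //; exists a.
have clZ a : clopen (mem a).
  split; first exact: (Zop a).1.
  by rewrite -[mem a]setCK; exact/open_closedC/(Zop a).2.
have cg : continuous g.
  apply: (continuous_subbasis bX) => V [[a _ <-]|[_ [a _ <-] <-]].
    by rewrite gpre; exact: (Zop a).1.
  by rewrite -preimage_setC gpre; exact: (Zop a).2.
(* Of two distinct points, one is not below the other, so some [mem a] separates them. *)
have Z0 : zero_dimensional Z.
  have sep (z w : Z) : ~ (z <= w)%O ->
      exists U : set Z, [/\ clopen U, U z & ~ U w].
    move=> nzw; apply: contrapT => nU; apply: nzw; apply/memle => a za.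
    by apply: contrapT => wa; apply: nU; exists (mem a).
  move=> z w zw; have [zw'|/sep//] := pselect (z <= w)%O.
  have [|U [cU Uw Uz]] := sep w z.
    by move=> wz; move: zw; rewrite (le_anti (introT andP (conj zw' wz))) eqxx.
  by exists (~` U); split=> //; exact: clopenC.
split; last first.
  exists f => //; split=> //; first by split=> //; exists g.
  apply/seteqP; split=> [_ [_ [a _ <-] <-]|_ [a _ <-]].
    by rewrite fimX; exists a.
  by exists (Xs a) => //; exists a.
split.
- split.
  + have -> : [set: Z] = f @` setT by rewrite fim.
    by apply: continuous_compact cX; exact: continuous_subspaceT.
  + exact: zero_dimensional_hausdorff.
  + exact: zero_dimension_totally_disconnected.
- move=> S; have [x [xlb xglb]] := infX (f @^-1` S).
  exists (f x); split=> [z Sz|z zlb].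
    by rewrite -[z]gf fle; apply: xlb; rewrite /= gf.
  by rewrite -[z]gf fle; apply: xglb => y Sy; rewrite -fle gf; exact: zlb.
- split=> // _ [[a _ <-]|[_ [a _ <-] <-]]; first exact: clZ.
  by apply: clopenC; [exact: mem a|exact: clZ].
(* The generators of [Z] are the images under [f] of those of [X]. *)
- have memE a : mem a = [set z | (f (p a) <= z)%O].
    rewrite -gpre pE; apply/seteqP; split=> z /=; first by rewrite -fle gf.
    by rewrite -{1}[z]gf fle.
  exists (f \o p); split=> // z; split=> [_ [a az <-]//|w wub].
  apply/memle => a; rewrite !memE /= => az.
  by apply: wub; exists a.
- apply: finI_from_sub; first by exists t.
  by move=> _ _ [a _ <-] [b _ <-]; exists (m a b).
Qed.

(** * Filters and ideals of a bisemilattice *)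

Definition filter_of (L : distrBisemilatticeType) (F : set L) (fF : bfilter F) :
    filters L :=
  exist _ F (mem_set (fF : [set F : set L | bfilter F] F)).

Definition ideal_of (L : distrBisemilatticeType) (J : set L) (iJ : bideal J) :
    ideals L :=
  exist _ J (mem_set (iJ : [set J : set L | bideal J] J)).

Lemma has_mem_filterI (L : distrBisemilatticeType) (a b : L) :
  has_mem_filter (bmeet a b) = has_mem_filter a `&` has_mem_filter b.
Proof.
apply/seteqP; split=> -[F FF] /=; rewrite /has_mem_filter /=;
  have [_ Fup FI] := set_mem FF; last by case; exact: FI.
move=> Fab; split; apply: Fup Fab; rewrite /le_meet.
  by rewrite bmeetC bmeetA bmeetxx.
by rewrite -bmeetA bmeetxx.
Qed.

Lemma has_mem_idealI (L : distrBisemilatticeType) (a b : L) :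
  has_mem_ideal (bjoin a b) = has_mem_ideal a `&` has_mem_ideal b.
Proof.
apply/seteqP; split=> -[J JJ] /=; rewrite /has_mem_ideal /=;
  have [_ Jdn JU] := set_mem JJ; last by case; exact: JU.
move=> Jab; split; apply: Jdn Jab; rewrite /le_join.
  by rewrite bjoinA bjoinxx.
by rewrite bjoinC -bjoinA bjoinxx.
Qed.

Lemma filters_leP (L : distrBisemilatticeType) (F G : filters L) :
  (F <= G)%O <-> forall a, has_mem_filter a F -> has_mem_filter a G.
Proof. by rewrite filters_leE. Qed.

Lemma ideals_leP (L : distrBisemilatticeType) (I J : ideals L) :
  (I <= J)%O <-> forall a, has_mem_ideal a I -> has_mem_ideal a J.
Proof. by rewrite ideals_leE. Qed.

Lemma filters_basis (L : distrBisemilatticeType) :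
  basis (finI_from (with_compl (range (@has_mem_filter L))) id).
Proof. exact: open_from_basis. Qed.

Lemma ideals_basis (L : distrBisemilatticeType) :
  basis (finI_from (with_compl (range (@has_mem_ideal L))) id).
Proof. exact: open_from_basis. Qed.

(** Testing on the principal filter of [c] gives one inequality; the other follows by symmetry. *)
Lemma has_mem_filter_inj (L : distrBisemilatticeType) :
  injective (@has_mem_filter L).
Proof.
have le_of (b c : L) : has_mem_filter b = has_mem_filter c -> le_meet c b.
  move=> bc; have fF : bfilter [set e | le_meet c e].
    split; rewrite /le_meet /=; first by exists c; exact: bmeetxx.
    - by move=> e g eg ce; rewrite -ce -bmeetA eg.
    - by move=> e g ce cg; rewrite bmeetA ce.
  have : has_mem_filter c (filter_of fF) by exact: bmeetxx.
  by rewrite -bc.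
by move=> a b ab; rewrite -(le_of _ _ ab) bmeetC (le_of _ _ (esym ab)).
Qed.

Lemma has_mem_ideal_inj (L : distrBisemilatticeType) :
  injective (@has_mem_ideal L).
Proof.
have le_of (b c : L) : has_mem_ideal b = has_mem_ideal c -> le_join b c.
  move=> bc; have iJ : bideal [set e | le_join e c].
    split; rewrite /le_join /=; first by exists c; exact: bjoinxx.
    - by move=> e g eg gc; rewrite -gc bjoinA eg.
    - by move=> e g ec gc; rewrite -bjoinA gc.
  have : has_mem_ideal c (ideal_of iJ) by exact: bjoinxx.
  by rewrite -bc.
by move=> a b ab; rewrite -(le_of _ _ ab) bjoinC (le_of _ _ (esym ab)).
Qed.

Lemma filters_trace d (X : POrderedTopological.type d)
    (L : distrBisemilatticeType) (t : L) (Xs : L -> set X) (x : X) :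
  (forall a b, Xs (bmeet a b) = Xs a `&` Xs b) -> Xs t = setT ->
  exists F : filters L, forall a, has_mem_filter a F <-> Xs a x.
Proof.
move=> Xm Xt; suff fF : bfilter [set a | Xs a x].
  by exists (filter_of fF).
split=> [|a b ab|a b ax bx] /=; first by exists t; rewrite /= Xt.
  by rewrite -ab Xm => -[].
by rewrite Xm.
Qed.

Lemma ideals_trace d (X : POrderedTopological.type d)
    (L : distrBisemilatticeType) (t : L) (Xs : L -> set X) (x : X) :
  (forall a b, Xs (bjoin a b) = Xs a `&` Xs b) -> Xs t = setT ->
  exists J : ideals L, forall a, has_mem_ideal a J <-> Xs a x.
Proof.
move=> Xm Xt; suff iJ : bideal [set a | Xs a x].
  by exists (ideal_of iJ).
split=> [|a b ab|a b ax bx] /=; first by exists t; rewrite /= Xt.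
  by rewrite -ab Xm => -[].
by rewrite Xm.
Qed.

Lemma filters_Fspace d (X : POrderedTopological.type d)
    (L : distrBisemilatticeType) (Xs : L -> set X) :
  Fspace Xs -> injective Xs ->
  (forall a b, Xs (bmeet a b) = Xs a `&` Xs b) ->
  Fspace (@has_mem_filter L) /\
  exists2 f, Fspace_iso Xs (@has_mem_filter L) f &
    forall a, f @` Xs a = has_mem_filter a.
Proof.
move=> hX Xinj Xm.
have [t _ Xt] : range Xs setT.
  have [_ _ _ _] := hX; apply.
  by exists fset0 => //; rewrite set_fset0 bigcap_set0.
apply: (@Fspace_iso_mem _ _ X (filters L) L (@bmeet L) t) => //.
- exact: has_mem_filterI.
(* [t] is the top for [le_meet], so every filter, being nonempty, contains it. *)
- apply/seteqP; split=> // -[F FF] _; have [[a Fa] Fup _] := set_mem FF.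
  apply: (Fup a) => //; apply: Xinj.
  by rewrite Xm Xt setIT.
- exact: filters_leP.
- exact: filters_basis.
- by move=> x; exact: filters_trace Xt.
Qed.

(** Joins now index intersections: a larger index for [le_join] names a smaller basic set, and [t]
    is the bottom. *)
Lemma ideals_Fspace d (X : POrderedTopological.type d)
    (L : distrBisemilatticeType) (Xs : L -> set X) :
  Fspace Xs -> injective Xs ->
  (forall a b, Xs (bjoin a b) = Xs a `&` Xs b) ->
  Fspace (@has_mem_ideal L) /\
  exists2 f, Fspace_iso Xs (@has_mem_ideal L) f &
    forall a, f @` Xs a = has_mem_ideal a.
Proof.
move=> hX Xinj Xm.
have [t _ Xt] : range Xs setT.
  have [_ _ _ _] := hX; apply.
  by exists fset0 => //; rewrite set_fset0 bigcap_set0.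
apply: (@Fspace_iso_mem _ _ X (ideals L) L (@bjoin L) t) => //.
- exact: has_mem_idealI.
- apply/seteqP; split=> // -[J JJ] _; have [[a Ja] Jdn _] := set_mem JJ.
  apply: (Jdn t a) => //; apply: Xinj.
  by rewrite Xm Xt setTI.
- exact: ideals_leP.
- exact: ideals_basis.
- by move=> x; exact: ideals_trace Xt.
Qed.

(** * The 2space of a bisemilattice and the isomorphism *)

Lemma rho_invK (T : twospace_data) (P : set (lspace T)) :
  set_inj (@lstar T) (@rho T) -> lstar P -> rho_inv (rho P) = P.
Proof. by move=> rinj TP; apply: pinvKV => //; exact: mem_set. Qed.

(** Since meets and joins index intersections of basic sets on the left and right, De Morgan reduces
    the identities on [rho] to [bmeetUr] and [bjoinIr]. *)
Lemma twospace_of_twospace (L : distrBisemilatticeType) :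
  Fspace (@has_mem_filter L) -> Fspace (@has_mem_ideal L) ->
  twospace (twospace_of L).
Proof.
move=> FL IL; pose T := twospace_of L.
have rinj : set_inj (@lstar T) (@rho T).
  move=> _ _ /set_mem[a _ <-] /set_mem[b _ <-] /=.
  by rewrite !rho_of_has_mem => /setC_inj/has_mem_ideal_inj ->.
have invE a : @rho_inv T (~` has_mem_ideal a) = has_mem_filter a.
  rewrite -rho_of_has_mem; apply: (@rho_invK T _ rinj).
  by exists a.
split=> //=.
- split=> // [_ [a _ <-]|].
    by rewrite /= rho_of_has_mem; exists (has_mem_ideal a) => //; exists a.
  move=> _ [_ [a _ <-] <-]; exists (has_mem_filter a); first by exists a.
  exact: rho_of_has_mem.
- exact: rho_of_has_mem.
- move=> _ _ _ [a _ <-] [b _ <-] [c _ <-] /=.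
  by rewrite -!has_mem_filterI !rho_of_has_mem -!setCI -!has_mem_idealI !invE
    -has_mem_filterI bmeetUr.
- move=> _ _ _ [_ [a _ <-] <-] [_ [b _ <-] <-] [_ [c _ <-] <-] /=.
  by rewrite -!setCI -!has_mem_idealI !invE -!has_mem_filterI !rho_of_has_mem
    -!setCI -has_mem_idealI bjoinIr.
Qed.

Lemma twospace_iso_of (T : twospace_data) (L : distrBisemilatticeType)
    (Xs : L -> set (lspace T)) : twospace T ->
  injective Xs -> range Xs = @lstar T ->
  (forall a b, Xs (bmeet a b) = Xs a `&` Xs b) ->
  (forall a b, rho (Xs (bjoin a b)) = rho (Xs a) `|` rho (Xs b)) ->
  twospace (twospace_of L) /\ twospace_iso T (twospace_of L).
Proof.
move=> [[hX hY] [rfun rinj rsurj] rE _ _] Xinj XT Xm Xj.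
have XsT a : lstar (Xs a) by rewrite -XT; exists a.
(* The right basic sets, reindexed by [L]; complementing makes joins into intersections, as
   [ideals_Fspace] requires. *)
pose Ys a := ~` rho (Xs a).
have Yinj : injective Ys.
  by move=> a b /setC_inj ab; apply/Xinj/rinj => //; exact: mem_set.
have YT : range (@rsub T) = range Ys.
  apply/seteqP; split=> [_ [i _ <-]|_ [a _ <-]].
    have : lstar (lsub i) by exists i.
    by rewrite -XT => -[a _ aE]; exists a => //; rewrite /Ys aE rE setCK.
  by have [i _ iE] := XsT a; exists i => //; rewrite /Ys -iE rE setCK.
have [FL [f isof fE]] := filters_Fspace (Fspace_range (esym XT) hX) Xinj Xm.
have [|IL [g isog gE]] := ideals_Fspace (Fspace_range YT hY) Yinj.
  by move=> a b; rewrite /Ys Xj setCU.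
split; first exact: twospace_of_twospace.
exists f, g; split=> /=.
- by case: isof; rewrite XT; split.
- by case: isog; rewrite -YT; split.
move=> P; rewrite -XT => -[a _ <-]; rewrite fE rho_of_has_mem -gE.
have [_ [h [gh hg _]]] : homeomorphism g by case: isog.
(* [rho] yields complements of basic sets, and the bijection [g] commutes with complements. *)
have gimC V : g @` (~` V) = ~` (g @` V).
  apply/seteqP; split=> [_ [y nVy <-] [z Vz /(can_inj gh) zy]|w nVw].
    by apply: nVy; rewrite -zy.
  by exists (h w) => // Vhw; apply: nVw; exists (h w).
by rewrite -gimC /Ys setCK.
Qed.

Theorem theorem6p7 (T : twospace_data) (hT : twospace T) :
  exists L : distrBisemilatticeType,
    twospace (twospace_of L) /\ twospace_iso T (twospace_of L).
Proof.
have [[hX hY] [rfun rinj rsurj] rE dmj djm] := hT.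
have starI d (X : POrderedTopological.type d) A (Xs : A -> set X) :
    Fspace Xs -> setI_closed (range Xs).
  by move=> [_ _ _ _ fin] P Q XP XQ; apply: fin; apply: finI_fromI;
    exact: finI_from1.
have lI := starI _ _ _ _ hX.
(* Needed to define joins: the union of two values of [rho] must again be a value of [rho]. *)
have rU (P Q : set (rspace T)) : rcostar P -> rcostar Q -> rcostar (P `|` Q).
  move=> [U YU <-] [V YV <-]; exists (U `&` V); last exact: setCI.
  exact: starI hY _ _ _ _.
(* The carrier consists of the basic sets, not of the indices, since several indices may name one
   set. *)
pose L := {P | @lstar T P}.
have Linj : injective (@sval _ _ : L -> _).
  by move=> [P hP] [Q hQ] /= PQ; exact: eq_exist.
have /choice [mt mtE] : forall u : L * L, exists w : L,
    sval w = sval u.1 `&` sval u.2.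
  by move=> [[P hP] [Q hQ]]; exists (exist _ _ (lI _ _ hP hQ)).
have /choice [jn jnE] : forall u : L * L, exists w : L,
    rho (sval w) = rho (sval u.1) `|` rho (sval u.2).
  move=> [[P hP] [Q hQ]] /=.
  have [R hR RE] := rsurj _ (rU _ _ (rfun _ hP) (rfun _ hQ)).
  by exists (exist _ R hR).
pose m a b := mt (a, b); pose j a b := jn (a, b).
have mE a b : sval (m a b) = sval a `&` sval b := mtE (a, b).
have jE a b : rho (sval (j a b)) = rho (sval a) `|` rho (sval b) := jnE (a, b).
have rhoinj (a b : L) : rho (sval a) = rho (sval b) -> a = b.
  by move=> ab; apply/Linj/rinj => //; apply/mem_set; exact: svalP.
(* This is the form in which joins occur in the identities [dmj] and [djm]. *)
have jV a b : sval (j a b) = rho_inv (rho (sval a) `|` rho (sval b)).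
  by rewrite -jE rho_invK //; exact: svalP.
have mxx : idempotent_op m by move=> a; apply: Linj; rewrite mE setIid.
have mC : commutative m by move=> a b; apply: Linj; rewrite !mE setIC.
have mA : associative m by move=> a b c; apply: Linj; rewrite !mE setIA.
have jxx : idempotent_op j by move=> a; apply: rhoinj; rewrite jE setUid.
have jC : commutative j by move=> a b; apply: rhoinj; rewrite !jE setUC.
have jA : associative j by move=> a b c; apply: rhoinj; rewrite !jE setUA.
have mj : right_distributive m j.
  move=> a b c; apply: Linj; rewrite mE !jV !mE.
  by apply: dmj; exact: svalP.
have rcs (a : L) : rcostar (rho (sval a)) by apply: rfun; exact: svalP.
(* [djm] concerns sets on the right, so this law is checked after applying the injective [rho]. *)
have jm : right_distributive j m.
  move=> a b c; apply: rhoinj; rewrite jE !mE !jV.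
  by rewrite -djm // !rho_invK //; exact: svalP.
pose LB : distrBisemilatticeType := HB.pack L
  (isDistrBisemilattice.Build L mxx mC mA jxx jC jA mj jm).
exists LB; apply: (@twospace_iso_of T LB (@sval _ _)) => //.
apply/seteqP; split=> [_ [[P hP] _ <-]//|P hP].
by exists (exist _ P hP).
Qed.
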